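(* Let $n\ge 1$ and let $V$ be a subset of $\mathbb{R}^n$. Then the congruence $\boldsymbol{E}(V)$ on $\overline{\boldsymbol{T}(X_1,\ldots,X_n)}$ is finitely generated (as a congruence) if and only if the closure $\overline{V}$ of $V$ in $\mathbb{R}^n$ (in the usual Euclidean topology) is a finite union of $\mathbb{R}$-rational polyhedral sets.
   Context: The tropical semifield is $\boldsymbol{T}=\mathbb{R}\cup\{-\infty\}$ with $a\oplus b=\max\{a,b\}$ and $a\odot b=a+b$ (and $a\oplus(-\infty)=a$, $a\odot(-\infty)=-\infty$); its zero is $-\infty$ and its one is $0$. $\boldsymbol{T}[X_1,\ldots,X_n]$ is the semiring of (formal) tropical polynomials. $\overline{\boldsymbol{T}[X_1,\ldots,X_n]}$ is its quotient identifying two tropical polynomials when they define the same function on $\boldsymbol{T}^n$; it is cancellative, and its semifield of fractions is the tropical rational function semifield $\overline{\boldsymbol{T}(X_1,\ldots,X_n)}$. An element $f\neq-\infty$ is of the form $f_1\odot f_2^{\odot(-1)}$ with $f_1,f_2\in\overline{\boldsymbol{T}[X_1,\ldots,X_n]}\setminus\{-\infty\}$ and defines a function $\mathbb{R}^n\to\mathbb{R}$, $f(x)=f_1(x)-f_2(x)$; the element $-\infty$ defines the constant function $-\infty$. A congruence on a semiring $S$ is a subset $E\subset S\times S$ that is an equivalence relation on $S$ and is closed under componentwise addition and multiplication. It is finitely generated if it is the smallest congruence containing some finite subset of it. For $V\subset\mathbb{R}^n$, $\boldsymbol{E}(V)=\{(f,g)\in\overline{\boldsymbol{T}(X_1,\ldots,X_n)}^2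 \mid f(x)=g(x)\text{ for all }x\in V\}$. A polyhedral set in $\mathbb{R}^n$ is the solution set of a finite system of linear inequalities $c_i\cdot y+a_i\le 0$ ($c_i\in\mathbb{R}^n$, $a_i\in\mathbb{R}$); it is $\mathbb{R}$-rational if all coefficients other than the constant terms are rational (i.e. $c_i\in\mathbb{Q}^n$, $a_i\in\mathbb{R}$). *)

(* Defs.v *)
From HB Require Import structures.
From mathcomp Require Import all_boot all_order all_algebra.
From mathcomp Require Import finmap generic_quotient.
From mathcomp Require Import all_classical all_reals all_analysis.

Set Implicit Arguments.
Unset Strict Implicit.
Unset Printing Implicit Defensive.

Import Order.TTheory GRing.Theory Num.Theory.

Local Open Scope classical_set_scope.
Local Open Scope quotient_scope.
Local Open Scope ring_scope.

(* The tropical semifield: None stands for -oo, so that the ring operations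
   0, 1, +, * of the instance below are -oo, Some 0, max and +. *)
Definition trop (R : realType) : Type := option R.

HB.instance Definition _ (R : realType) := Choice.copy (trop R) (option R).

Section Trop.
Variable R : realType.
Implicit Types a b c : trop R.

Definition tadd a b : trop R :=
  match a, b with
  | None, _ => b
  | _, None => a
  | Some r, Some s => Some (Num.max r s)
  end.

Definition tmul a b : trop R :=
  match a, b with
  | Some r, Some s => Some (r + s)
  | _, _ => None
  end.

Definition tinv a : trop R := omap -%R a.

Fact taddA : associative tadd.
Proof. by move=> [x|] [y|] [z|] //=; rewrite maxA. Qed.
Fact taddC : commutative tadd.
Proof. by move=> [x|] [y|] //=; rewrite maxC. Qed.
Fact tadd0 : left_id None tadd.
Proof. by case. Qed.
Fact tmulA : associative tmul.
Proof. by move=> [x|] [y|] [z|] //=; rewrite addrA. Qed.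
Fact tmulC : commutative tmul.
Proof. by move=> [x|] [y|] //=; rewrite addrC. Qed.
Fact tmul1 : left_id (Some 0) tmul.
Proof. by move=> [x|] //=; rewrite add0r. Qed.
Fact tmulDl : left_distributive tmul tadd.
Proof. by move=> [x|] [y|] [z|] //=; rewrite addr_maxl. Qed.
Fact tmul0 : left_zero None tmul.
Proof. by []. Qed.
Fact tone_neq0 : (Some 0 : trop R) != None.
Proof. by []. Qed.

HB.instance Definition _ := GRing.isNmodule.Build (trop R) taddA taddC tadd0.
HB.instance Definition _ := GRing.Nmodule_isComNzSemiRing.Build (trop R)
  tmulA tmulC tmul1 tmulDl tmul0 tone_neq0.

Lemma trop_add_eq0 a b : a + b = 0 -> a = 0 /\ b = 0.
Proof. by case: a b => [x|] [y|]. Qed.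

Lemma trop_mul_eq0 a b : a * b = 0 -> a = 0 \/ b = 0.
Proof. by case: a b => [x|] [y|] //; [right|left|left]. Qed.

Lemma trop_prod_neq0 (I : Type) (r : seq I) (F : I -> trop R) :
  (forall i, F i <> 0) -> \prod_(i <- r) F i <> 0.
Proof.
move=> F0; elim/big_rec: _ => // i a _ a0 /trop_mul_eq0[] //; exact: F0.
Qed.

Lemma trop_exp_neq0 a k : a <> 0 -> a ^+ k <> 0.
Proof.
move=> a0; elim: k => [|k ih] //; rewrite exprS => /trop_mul_eq0[]; tauto.
Qed.

Lemma tinvK a b : b <> 0 -> a * b * tinv b = a.
Proof. by case: a b => [x|] [y|] //= _; congr Some; rewrite addrK. Qed.

Lemma tmulVK a b : b <> 0 -> a * tinv b * b = a.
Proof. by case: a b => [x|] [y|] //= _; congr Some; rewrite addrNK. Qed.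

Lemma tinvM a b : tinv (a * b) = tinv a * tinv b.
Proof. by case: a b => [x|] [y|] //=; congr Some; rewrite opprD. Qed.

Lemma tdivP a b c d : b <> 0 -> d <> 0 ->
  a * tinv b = c * tinv d <-> a * d = c * b.
Proof.
move=> b0 d0; split=> [e|e].
  by rewrite -[a](tmulVK _ b0) e mulrAC tmulVK.
by rewrite -[a](tinvK _ d0) e mulrAC tinvK// mulrAC.
Qed.

Lemma tdivD a b c d : b <> 0 -> d <> 0 ->
  (a * d + c * b) * tinv (b * d) = a * tinv b + c * tinv d.
Proof.
move=> b0 d0; rewrite mulrDl tinvM [tinv b * _]mulrC !mulrA tinvK//.
by rewrite [X in _ + X]mulrAC tinvK.
Qed.

(* [tlim f a]: f t tends to a as t tends to +oo, where f is moreover eventually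
   equal to a when a is finite. *)
Definition tlim (f : R -> trop R) a : Prop :=
  if a is Some r then exists t0, forall t, t0 <= t -> f t = Some r
  else forall M, exists t0, forall t, t0 <= t ->
    if f t is Some s then s < M else true.

Lemma tlim_cst a : tlim (fun=> a) a.
Proof. by case: a => [x|] /=; [exists 0|move=> M; exists 0]. Qed.

Lemma tlim_uniq f a b : tlim f a -> tlim f b -> a = b.
Proof.
case: a b => [x|] [y|] //=.
- move=> [s fs] [t ft].
  by rewrite -(fs (Num.max s t)) ?le_max ?lexx// ft ?le_max ?lexx ?orbT.
- move=> [s fs] /(_ x)[t ft]; have := ft (Num.max s t).
  by rewrite fs ?le_max ?lexx ?orbT// ltxx => /(_ isT).
- move=> /(_ y)[t ft] [s fs]; have := ft (Num.max s t).
  by rewrite fs ?le_max ?lexx ?orbT// ltxx => /(_ isT).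
Qed.

Lemma tlimD f g a b : tlim f a -> tlim g b -> tlim (fun t => f t + g t) (a + b).
Proof.
case: a b => [x|] [y|] /=.
- move=> [s fs] [t gt]; exists (Num.max s t) => u.
  by rewrite ge_max => /andP[/fs -> /gt ->].
- move=> [s fs] /(_ x)[t gt]; exists (Num.max s t) => u.
  rewrite ge_max => /andP[/fs -> /gt]; case: (g u) => // z zx.
  by congr Some; rewrite max_l// ltW.
- move=> /(_ y)[s fs] [t gt]; exists (Num.max s t) => u.
  rewrite ge_max => /andP[/fs + /gt ->]; case: (f u) => // z zx.
  by congr Some; rewrite max_r// ltW.
- move=> fs gt M; have [s {}fs] := fs M; have [t {}gt] := gt M.
  exists (Num.max s t) => u.
  rewrite ge_max => /andP[/fs + /gt]; case: (f u) (g u) => [x|] [y|] //=.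
  by rewrite gt_max => -> ->.
Qed.

Lemma tlimM f g a b : tlim f a -> tlim g b -> tlim (fun t => f t * g t) (a * b).
Proof.
case: a b => [x|] [y|] /=.
- move=> [s fs] [t gt]; exists (Num.max s t) => u.
  by rewrite ge_max => /andP[/fs -> /gt ->].
- move=> [s fs] gt M; have [t {}gt] := gt (M - x); exists (Num.max s t) => u.
  rewrite ge_max => /andP[/fs -> /gt]; case: (g u) => //= z.
  by rewrite ltrBrDl.
- move=> fs [t gt] M; have [s {}fs] := fs (M - y); exists (Num.max s t) => u.
  rewrite ge_max => /andP[/fs + /gt ->]; case: (f u) => //= z.
  by rewrite ltrBrDr.
- move=> fs gt M; have [s {}fs] := fs 0; have [t {}gt] := gt M.
  exists (Num.max s t) => u.
  rewrite ge_max => /andP[/fs + /gt]; case: (f u) (g u) => [x|] [y|] //= x0 yM.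
  by rewrite -[M]add0r ltrD.
Qed.

End Trop.

(* Formal tropical polynomials, as finitely supported families of coefficients
   indexed by exponent vectors. *)
Definition tpoly (R : realType) (n : nat) : Type :=
  {fsfun {ffun 'I_n -> nat} -> trop R with 0}.

HB.instance Definition _ (R : realType) (n : nat) := Choice.copy (tpoly R n)
  {fsfun {ffun 'I_n -> nat} -> trop R with 0}.

Section TPoly.
Local Open Scope fset_scope.
Local Open Scope ring_scope.
Variables (R : realType) (n : nat).
Implicit Types (p q : tpoly R n) (v : 'I_n -> trop R) (m : {ffun 'I_n -> nat}).

Definition teval v p : trop R :=
  \sum_(m <- finsupp p) p m * \prod_(i < n) v i ^+ m i.

Definition tpoly0 : tpoly R n := [fsfun].

Definition tpoly1 : tpoly R n := [fsfun m in [fset 0] => 1].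

Definition tpolyD p q : tpoly R n :=
  [fsfun m in finsupp p `|` finsupp q => p m + q m].

Definition tpolyM p q : tpoly R n :=
  [fsfun m in [fset a + b | a in finsupp p, b in finsupp q] =>
     \sum_(a <- finsupp p) \sum_(b <- finsupp q | a + b == m) p a * q b].

Lemma teval_fsfun v (A : {fset {ffun 'I_n -> nat}}) F :
  teval v [fsfun m in A => F m] = \sum_(m <- A) F m * \prod_i v i ^+ m i.
Proof.
rewrite /teval (big_fset_incl _ (finsupp_sub _ _ _)) /=; last first.
  by move=> m mA; rewrite memNfinsupp => /eqP ->; rewrite mul0r.
by rewrite !big_seq; apply: eq_bigr => m mA; rewrite fsfun_fun mA.
Qed.

Lemma teval_wide v p (A : {fset {ffun 'I_n -> nat}}) :
  (finsupp p `<=` A)%fset ->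
  teval v p = \sum_(m <- A) p m * \prod_i v i ^+ m i.
Proof.
move=> pA; rewrite /teval (big_fset_incl _ pA) //.
by move=> m mA; rewrite memNfinsupp => /eqP ->; rewrite mul0r.
Qed.

Lemma teval0 v : teval v tpoly0 = 0.
Proof. by rewrite /teval finsupp0 big_seq_fset0. Qed.

Lemma teval1 v : teval v tpoly1 = 1.
Proof.
rewrite teval_fsfun big_seq_fset1 mul1r big1 // => i _.
by rewrite ffunE expr0.
Qed.

Lemma tevalD v p q : teval v (tpolyD p q) = teval v p + teval v q.
Proof.
rewrite teval_fsfun (teval_wide v (fsubsetUl (finsupp p) (finsupp q))).
rewrite (teval_wide v (fsubsetUr (finsupp p) (finsupp q))) -big_split /=.
by apply: eq_bigr => m _; rewrite mulrDl.
Qed.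

Lemma tevalM v p q : teval v (tpolyM p q) = teval v p * teval v q.
Proof.
rewrite teval_fsfun; under eq_bigr do rewrite mulr_suml.
rewrite exchange_big /= /teval mulr_suml [LHS]big_seq [RHS]big_seq; apply: eq_bigr => a ap.
under eq_bigr do rewrite mulr_suml big_mkcond /=.
rewrite exchange_big /= mulr_sumr [LHS]big_seq [RHS]big_seq; apply: eq_bigr => b bq.
rewrite (bigD1_seq (a + b)) ?in_imfset2 ?fset_uniq //= eqxx.
rewrite [X in _ + X]big1 ?addr0; last first.
  by move=> m; rewrite eq_sym => /negPf ->.
rewrite mulrACA -big_split /=; congr (_ * _).
by apply: eq_bigr => i _; rewrite ffunE exprD.
Qed.

Definition tpoly_eqv : rel (tpoly R n) :=
  fun p q => `[< forall v, teval v p = teval v q >].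

Fact tpoly_eqv_refl : reflexive tpoly_eqv.
Proof. by move=> p; apply/asboolP. Qed.
Fact tpoly_eqv_sym : symmetric tpoly_eqv.
Proof.
by move=> p q; apply/asboolP/asboolP => h v; rewrite h.
Qed.
Fact tpoly_eqv_trans : transitive tpoly_eqv.
Proof.
by move=> q p r /asboolP h1 /asboolP h2; apply/asboolP => v; rewrite h1.
Qed.

Canonical tpoly_eqv_equiv :=
  EquivRel tpoly_eqv tpoly_eqv_refl tpoly_eqv_sym tpoly_eqv_trans.

Definition finpt (x : 'rV[R]_n) : 'I_n -> trop R := fun i => Some (x 0 i).

Lemma teval_finpt_eq0 p x : teval (finpt x) p = 0 -> forall v, teval v p = 0.
Proof.
move=> p0; suff -> : p = tpoly0 by move=> v; exact: teval0.
apply/fsfunP => m; rewrite fsfun0E.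
apply/eqP; rewrite -memNfinsupp; apply/negP => mp.
move: p0; rewrite /teval (bigD1_seq m) ?fset_uniq //=.
move=> /trop_add_eq0[/trop_mul_eq0[pm _|]].
  by move: mp; rewrite mem_finsupp pm eqxx.
by move=> /trop_prod_neq0 + _; apply=> i; exact: trop_exp_neq0.
Qed.

Lemma teval_finpt_ext p q : (forall x, teval (finpt x) p = teval (finpt x) q) ->
  forall v, teval v p = teval v q.
Proof.
move=> pq v.
pose x (t : R) : 'rV[R]_n := \row_i odflt (- t) (v i).
have lim r : tlim (fun t => teval (finpt (x t)) r) (teval v r).
  rewrite /teval; elim: (finsupp r : seq _) => [|m s ih].
    under [X in tlim X]funext do rewrite big_nil; rewrite big_nil.
    exact: tlim_cst.
  under [X in tlim X]funext do rewrite big_cons; rewrite big_cons.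
  apply: tlimD ih; apply: tlimM; first exact: tlim_cst.
  elim: (index_enum _) => [|i l ih].
    under [X in tlim X]funext do rewrite big_nil; rewrite big_nil.
    exact: tlim_cst.
  under [X in tlim X]funext do rewrite big_cons; rewrite big_cons.
  apply: tlimM ih; elim: (m i) => [|k ih].
    under [X in tlim X]funext do rewrite expr0; rewrite expr0.
    exact: tlim_cst.
  under [X in tlim X]funext do rewrite exprS; rewrite exprS.
  apply: tlimM ih; rewrite /finpt /x.
  under [X in tlim X]funext do rewrite mxE.
  case: (v i) => [y|] /=; first by exists 0.
  move=> M; exists (1 - M) => t h.
  by rewrite ltrNl (lt_le_trans _ h)// -subr_gt0 opprK subrK ltr01.
have := lim q; under [X in tlim X]funext do rewrite -pq.
exact/tlim_uniq/lim.
Qed.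

End TPoly.

(* Tropical polynomials up to equality as functions on T^n. *)
Definition tpolyfun (R : realType) (n : nat) : Type :=
  {eq_quot (@tpoly_eqv R n)}.

HB.instance Definition _ (R : realType) (n : nat) :=
  Choice.on (tpolyfun R n).
HB.instance Definition _ (R : realType) (n : nat) :=
  EqQuotient.on (tpolyfun R n).

Section TPolyFun.
Variables (R : realType) (n : nat).
Implicit Types (f g h : tpolyfun R n) (p q : tpoly R n) (v : 'I_n -> trop R).

Definition pfeval v f : trop R := teval v (repr f).

Definition pf0 : tpolyfun R n := \pi_(tpolyfun R n) (tpoly0 R n).
Definition pf1 : tpolyfun R n := \pi_(tpolyfun R n) (tpoly1 R n).
Definition pfadd f g : tpolyfun R n := \pi_(tpolyfun R n) (tpolyD (repr f) (repr g)).
Definition pfmul f g : tpolyfun R n := \pi_(tpolyfun R n) (tpolyM (repr f) (repr g)).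

Lemma pfeval_pi v p : pfeval v (\pi_(tpolyfun R n) p) = teval v p.
Proof.
suff /eqquotP/asboolP : repr (\pi_(tpolyfun R n) p) = p %[mod tpolyfun R n].
  exact.
by rewrite reprK.
Qed.

Lemma pfeval_inj f g : (forall v, pfeval v f = pfeval v g) -> f = g.
Proof. by move=> fg; rewrite -[f]reprK -[g]reprK; exact/eqquotP/asboolP. Qed.

Fact pfeval_0 v : pfeval v pf0 = 0.
Proof. by rewrite pfeval_pi teval0. Qed.
Fact pfeval_1 v : pfeval v pf1 = 1.
Proof. by rewrite pfeval_pi teval1. Qed.
Fact pfeval_add v f g : pfeval v (pfadd f g) = pfeval v f + pfeval v g.
Proof. by rewrite pfeval_pi tevalD. Qed.
Fact pfeval_mul v f g : pfeval v (pfmul f g) = pfeval v f * pfeval v g.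
Proof. by rewrite pfeval_pi tevalM. Qed.

Let pfE := (pfeval_0, pfeval_1, pfeval_add, pfeval_mul).

Fact pfaddA : associative pfadd.
Proof. by move=> f g h; apply: pfeval_inj => v; rewrite !pfE addrA. Qed.
Fact pfaddC : commutative pfadd.
Proof. by move=> f g; apply: pfeval_inj => v; rewrite !pfE addrC. Qed.
Fact pfadd0 : left_id pf0 pfadd.
Proof. by move=> f; apply: pfeval_inj => v; rewrite !pfE add0r. Qed.
Fact pfmulA : associative pfmul.
Proof. by move=> f g h; apply: pfeval_inj => v; rewrite !pfE mulrA. Qed.
Fact pfmulC : commutative pfmul.
Proof. by move=> f g; apply: pfeval_inj => v; rewrite !pfE mulrC. Qed.
Fact pfmul1 : left_id pf1 pfmul.
Proof. by move=> f; apply: pfeval_inj => v; rewrite !pfE mul1r. Qed.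
Fact pfmulDl : left_distributive pfmul pfadd.
Proof. by move=> f g h; apply: pfeval_inj => v; rewrite !pfE mulrDl. Qed.
Fact pfmul0 : left_zero pf0 pfmul.
Proof. by move=> f; apply: pfeval_inj => v; rewrite !pfE mul0r. Qed.
Fact pfone_neq0 : pf1 != pf0.
Proof.
by apply/eqP => /(congr1 (pfeval (fun=> 0))); rewrite !pfE => /eqP.
Qed.

HB.instance Definition _ :=
  GRing.isNmodule.Build (tpolyfun R n) pfaddA pfaddC pfadd0.
HB.instance Definition _ := GRing.Nmodule_isComNzSemiRing.Build (tpolyfun R n)
  pfmulA pfmulC pfmul1 pfmulDl pfmul0 pfone_neq0.

Lemma pfeval0 v : pfeval v 0 = 0. Proof. exact: pfeval_0. Qed.
Lemma pfeval1 v : pfeval v 1 = 1. Proof. exact: pfeval_1. Qed.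
Lemma pfevalD v f g : pfeval v (f + g) = pfeval v f + pfeval v g.
Proof. exact: pfeval_add. Qed.
Lemma pfevalM v f g : pfeval v (f * g) = pfeval v f * pfeval v g.
Proof. exact: pfeval_mul. Qed.

Lemma pfeval_finpt_inj f g :
  (forall x, pfeval (finpt x) f = pfeval (finpt x) g) -> f = g.
Proof. by move=> fg; apply: pfeval_inj; exact: teval_finpt_ext. Qed.

Lemma pfeval_neq0 f x : f != 0 -> pfeval (finpt x) f <> 0.
Proof.
move=> /eqP f0 fx; apply: f0; apply: pfeval_inj => v.
by rewrite pfeval0; exact: (teval_finpt_eq0 fx).
Qed.

Lemma pfmul_neq0 f g : f != 0 -> g != 0 -> f * g != 0.
Proof.
move=> f0 g0; apply/eqP => /(congr1 (pfeval (finpt 0))).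
rewrite pfevalM pfeval0 => /trop_mul_eq0[]; exact: pfeval_neq0.
Qed.

Lemma pf_cancel h f g : h != 0 -> f * h = g * h -> f = g.
Proof.
move=> h0 fg; apply: pfeval_finpt_inj => x; have hx := @pfeval_neq0 h x h0.
by rewrite -[LHS](tinvK _ hx) -pfevalM fg pfevalM tinvK.
Qed.

Definition tpair : Type := {fg : tpolyfun R n * tpolyfun R n | fg.2 != 0}.
HB.instance Definition _ := Choice.on tpair.

Implicit Types a b c : tpair.

(* No extra multiplier is needed, by cancellativity (pf_cancel). *)
Definition tpair_eqv : rel tpair := fun a b =>
  (val a).1 * (val b).2 == (val b).1 * (val a).2.

Fact tpair_eqv_refl : reflexive tpair_eqv.
Proof. by move=> a; exact: eqxx. Qed.
Fact tpair_eqv_sym : symmetric tpair_eqv.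
Proof. by move=> a b; rewrite /tpair_eqv eq_sym. Qed.
Fact tpair_eqv_trans : transitive tpair_eqv.
Proof.
move=> b a c /eqP ab /eqP bc; apply/eqP; apply: (pf_cancel (valP b)).
by rewrite mulrAC ab mulrAC bc mulrAC.
Qed.

Canonical tpair_eqv_equiv :=
  EquivRel tpair_eqv tpair_eqv_refl tpair_eqv_sym tpair_eqv_trans.

End TPolyFun.

Definition tratfun (R : realType) (n : nat) : Type :=
  {eq_quot (@tpair_eqv R n)}.

HB.instance Definition _ (R : realType) (n : nat) := Choice.on (tratfun R n).
HB.instance Definition _ (R : realType) (n : nat) :=
  EqQuotient.on (tratfun R n).

Section TRatFun.
Variables (R : realType) (n : nat).
Implicit Types (f g h : tratfun R n) (a b c : tpair R n) (x : 'rV[R]_n).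

Definition mkfrac (p q : tpolyfun R n) (q0 : q != 0) : tratfun R n :=
  \pi_(tratfun R n) (exist _ (p, q) q0).

Definition rfnum f : tpolyfun R n := (val (repr f)).1.
Definition rfden f : tpolyfun R n := (val (repr f)).2.

Lemma rfden_neq0 f : rfden f != 0. Proof. exact: valP (repr f). Qed.

(* numerator minus denominator; by rfeval_mkfrac, this does not depend on the
   representative. *)
Definition rfeval x f : trop R :=
  pfeval (finpt x) (rfnum f) * tinv (pfeval (finpt x) (rfden f)).

Definition rf0 : tratfun R n := mkfrac 0 (oner_neq0 (tpolyfun R n)).
Definition rf1 : tratfun R n := mkfrac 1 (oner_neq0 (tpolyfun R n)).
Definition rfadd f g : tratfun R n :=
  mkfrac (rfnum f * rfden g + rfnum g * rfden f)
         (pfmul_neq0 (rfden_neq0 f) (rfden_neq0 g)).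
Definition rfmul f g : tratfun R n :=
  mkfrac (rfnum f * rfnum g) (pfmul_neq0 (rfden_neq0 f) (rfden_neq0 g)).

Lemma rfeval_mkfrac x p q (q0 : q != 0) : rfeval x (mkfrac p q0) =
  pfeval (finpt x) p * tinv (pfeval (finpt x) q).
Proof.
have e : rfnum (mkfrac p q0) * q = p * rfden (mkfrac p q0).
  suff /eqquotP/eqP : repr (mkfrac p q0) = exist _ (p, q) q0 %[mod tratfun R n].
    exact.
  by rewrite reprK.
apply/tdivP; first exact/pfeval_neq0/rfden_neq0.
  exact: pfeval_neq0.
by rewrite -!pfevalM e.
Qed.

Lemma rfeval_inj f g : (forall x, rfeval x f = rfeval x g) -> f = g.
Proof.
move=> fg; rewrite -[f]reprK -[g]reprK; apply/eqquotP/eqP.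
apply: pfeval_finpt_inj => x; rewrite !pfevalM.
have := fg x; rewrite /rfeval => /tdivP; apply; exact/pfeval_neq0/rfden_neq0.
Qed.

Fact rfeval_0 x : rfeval x rf0 = 0.
Proof. by rewrite rfeval_mkfrac pfeval0 mul0r. Qed.
Fact rfeval_1 x : rfeval x rf1 = 1.
Proof. by rewrite rfeval_mkfrac pfeval1 -[LHS]mul1r mulrA tinvK. Qed.
Fact rfeval_add x f g : rfeval x (rfadd f g) = rfeval x f + rfeval x g.
Proof.
rewrite rfeval_mkfrac pfevalD !pfevalM tdivD//.
all: by apply: pfeval_neq0; exact: rfden_neq0.
Qed.
Fact rfeval_mul x f g : rfeval x (rfmul f g) = rfeval x f * rfeval x g.
Proof. by rewrite rfeval_mkfrac !pfevalM tinvM mulrACA. Qed.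

Let rfE := (rfeval_0, rfeval_1, rfeval_add, rfeval_mul).

Fact rfaddA : associative rfadd.
Proof. by move=> f g h; apply: rfeval_inj => x; rewrite !rfE addrA. Qed.
Fact rfaddC : commutative rfadd.
Proof. by move=> f g; apply: rfeval_inj => x; rewrite !rfE addrC. Qed.
Fact rfadd0 : left_id rf0 rfadd.
Proof. by move=> f; apply: rfeval_inj => x; rewrite !rfE add0r. Qed.
Fact rfmulA : associative rfmul.
Proof. by move=> f g h; apply: rfeval_inj => x; rewrite !rfE mulrA. Qed.
Fact rfmulC : commutative rfmul.
Proof. by move=> f g; apply: rfeval_inj => x; rewrite !rfE mulrC. Qed.
Fact rfmul1 : left_id rf1 rfmul.
Proof. by move=> f; apply: rfeval_inj => x; rewrite !rfE mul1r. Qed.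
Fact rfmulDl : left_distributive rfmul rfadd.
Proof. by move=> f g h; apply: rfeval_inj => x; rewrite !rfE mulrDl. Qed.
Fact rfmul0 : left_zero rf0 rfmul.
Proof. by move=> f; apply: rfeval_inj => x; rewrite !rfE mul0r. Qed.
Fact rfone_neq0 : rf1 != rf0.
Proof. by apply/eqP => /(congr1 (rfeval 0)); rewrite !rfE => /eqP. Qed.

HB.instance Definition _ :=
  GRing.isNmodule.Build (tratfun R n) rfaddA rfaddC rfadd0.
HB.instance Definition _ := GRing.Nmodule_isComNzSemiRing.Build (tratfun R n)
  rfmulA rfmulC rfmul1 rfmulDl rfmul0 rfone_neq0.

Lemma rfeval0 x : rfeval x 0 = 0. Proof. exact: rfeval_0. Qed.
Lemma rfeval1 x : rfeval x 1 = 1. Proof. exact: rfeval_1. Qed.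
Lemma rfevalD x f g : rfeval x (f + g) = rfeval x f + rfeval x g.
Proof. exact: rfeval_add. Qed.
Lemma rfevalM x f g : rfeval x (f * g) = rfeval x f * rfeval x g.
Proof. exact: rfeval_mul. Qed.

Lemma tratfun_divisible f : f != 0 -> exists g, f * g = 1.
Proof.
move=> f0; have nf0 : rfnum f != 0.
  apply/eqP => nf; move/eqP: f0; apply; apply: rfeval_inj => x.
  by rewrite rfeval0 /rfeval nf pfeval0 mul0r.
exists (mkfrac (rfden f) nf0); apply: rfeval_inj => x.
rewrite rfevalM rfeval_mkfrac rfeval1 mulrA /rfeval tmulVK; last first.
  exact/pfeval_neq0/rfden_neq0.
by rewrite -[X in X * _]mul1r tinvK//; exact: pfeval_neq0.
Qed.

End TRatFun.

Section Congruence.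
Variable S : pzSemiRingType.

Record congruence (E : set (S * S)) : Prop := {
  congruence_refl : forall a, E (a, a);
  congruence_sym : forall a b, E (a, b) -> E (b, a);
  congruence_trans : forall a b c, E (a, b) -> E (b, c) -> E (a, c);
  congruence_add : forall a b c d, E (a, b) -> E (c, d) -> E (a + c, b + d);
  congruence_mul : forall a b c d, E (a, b) -> E (c, d) -> E (a * c, b * d)
}.

Definition fg_congruence (E : set (S * S)) : Prop :=
  exists F : set (S * S),
    [/\ finite_set F, F `<=` E & E = smallest congruence F].

Lemma smallest_congruence (F : set (S * S)) :
  congruence (smallest congruence F).
Proof.
split.
- by move=> a A [cA _]; exact: congruence_refl cA a.
- move=> a b h A [cA FA]; apply: (congruence_sym cA); exact: h.
- move=> a b c h k A [cA FA].
  by apply: (congruence_trans cA (b := b)); [exact: h|exact: k].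
- move=> a b c d h k A [cA FA].
  by apply: (congruence_add cA); [exact: h|exact: k].
- move=> a b c d h k A [cA FA].
  by apply: (congruence_mul cA); [exact: h|exact: k].
Qed.

End Congruence.

Definition EV (R : realType) (n : nat) (V : set 'rV[R]_n) :
    set (tratfun R n * tratfun R n) :=
  [set fg | forall x, V x -> rfeval x fg.1 = rfeval x fg.2].

Lemma EV_congruence (R : realType) (n : nat) (V : set 'rV[R]_n) :
  congruence (EV V).
Proof.
split=> //=.
- by move=> f g h x /h.
- by move=> f g h fg gh x Vx; rewrite fg// gh.
- by move=> f g h k fg hk x Vx; rewrite !rfevalD fg// hk.
- by move=> f g h k fg hk x Vx; rewrite !rfevalM fg// hk.
Qed.

Definition polyhedron (R : realType) (m n : nat) (c : 'M[R]_(m, n))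
    (a : 'I_m -> R) : set 'rV[R]_n :=
  [set y | forall i, \sum_(j < n) c i j * y 0 j + a i <= 0].

Definition rational_polyhedral (R : realType) (n : nat) (P : set 'rV[R]_n) :
    Prop :=
  exists (m : nat) (c : 'M[rat]_(m, n)) (a : 'I_m -> R),
    P = polyhedron (map_mx ratr c) a.

(* Main.v *)
Require Import Defs.
From mathcomp Require Import all_boot all_order all_algebra finmap.
From mathcomp Require Import all_classical all_reals all_analysis.
From mathcomp Require Import lra ring.

Set Implicit Arguments.
Unset Strict Implicit.
Unset Printing Implicit Defensive.

Import Order.TTheory GRing.Theory Num.Theory.
Import numFieldNormedType.Exports.

Local Open Scope ring_scope.
Local Open Scope classical_set_scope.

(** A pair of tropical rational functions is read through its evaluations,
    which are piecewise affine with integer slopes, hence Lipschitz; in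
    particular [EV V] depends only on the closure of [V] ([EV_closure]).

    If [EV V] is generated by a finite set [F], then [closure V] is the common
    equalizer of the pairs of [F] ([closure_generators]): at a point [x] of
    that equalizer, evaluation at [x] is a congruence containing [F], hence
    [EV V], whereas for [x] outside the closure a tent function centred at [x]
    is identified with [1] on [V] but not at [x] ([bump]).  An equalizer of two
    maxima of integral affine forms is cut out by finitely many comparisons of
    such forms, so it is a finite union of rational polyhedra
    ([polyhedral_equalizer]).

    Conversely let [closure V] be the union of nonempty rational polyhedra
    [P_1], ..., [P_k], and let [h] be the minimum over [i] of the largest
    violation of the inequalities of [P_i].  Hoffman's error bound, proved here
    by Fourier-Motzkin elimination ([hoffman]), says that the distance to [P_i]
    is at most a constant times that violation, so [h] dominates a positive
    multiple of the distance to [closure V] ([polyhedral_gauge]).  After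
    clearing denominators, [h] is a tropical rational function that vanishes on
    [V].  Two functions [f] and [g] that agree on [V] are Lipschitz, so they
    differ by at most an integer multiple [k] of [h]; in semiring notation
    [f <= g * h ^+ k] and [g <= f * h ^+ k].  Modulo [h = 1] these become
    [f <= g] and [g <= f] ([congruence_sandwich]), so the single pair [(h, 1)]
    generates [EV V].  Being merely a tropical function with the right zero set
    is not enough for [h]: the linear growth away from [V] is what makes one
    exponent [k] work on all of the space. *)

(** * Affine forms and Hoffman's error bound *)

Section Hoffman.
Variables (R : realFieldType) (n : nat).
Implicit Types (l u : 'rV[R]_n * R) (x y z : 'rV[R]_n) (s : seq ('rV[R]_n * R)).

Definition aeval l x : R := \sum_(j < n) l.1 0 j * x 0 j + l.2.

Definition near_pt (d : R) x y : Prop := forall j, `|x 0 j - y 0 j| <= d.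

Lemma near_pt_sym d x y : near_pt d x y -> near_pt d y x.
Proof. by move=> xy j; rewrite distrC. Qed.

Lemma aevalD l u x : aeval (l + u) x = aeval l x + aeval u x.
Proof.
rewrite /aeval /= addrACA -big_split /=; congr (_ + _).
by apply: eq_bigr => j _; rewrite mxE mulrDl.
Qed.

Lemma aevalZ (a : R) l x : aeval (a *: l) x = a * aeval l x.
Proof.
rewrite /aeval /= mulrDr mulr_sumr; congr (_ + _).
by apply: eq_bigr => j _; rewrite mxE mulrA.
Qed.

Lemma aeval_move l x (k : 'I_n) (t : R) :
  aeval l (x + t *: delta_mx 0 k) = aeval l x + t * l.1 0 k.
Proof.
rewrite /aeval addrAC; congr (_ + _).
rewrite (bigD1 k) //= [in RHS](bigD1 k) //= !mxE !eqxx mulr1 mulrDr.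
rewrite [l.1 0 k * t]mulrC -!addrA; congr (_ + _); rewrite addrC.
congr (_ + _); apply: eq_bigr => j jk.
by rewrite !mxE (negPf jk) andbF mulr0 addr0.
Qed.

Definition slope l : R := \sum_j `|l.1 0 j|.

Lemma slope_ge0 l : 0 <= slope l.
Proof. exact: sumr_ge0. Qed.

Lemma aeval_lipschitz l x y d : near_pt d x y ->
  aeval l x <= aeval l y + slope l * d.
Proof.
move=> xy; rewrite /aeval addrAC lerD2r /slope mulr_suml -big_split /=.
apply: ler_sum => j _; rewrite -lerBlDl -mulrBr.
by apply: le_trans (ler_norm _) _; rewrite normrM ler_wpM2l.
Qed.

Lemma ler_sum_mem (T : eqType) (r : seq T) (F : T -> R) i :
  (forall j, 0 <= F j) -> i \in r -> F i <= \sum_(j <- r) F j.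
Proof.
move=> F0; elim: r => // j r ih; rewrite inE big_cons => /predU1P[->|/ih h].
  by rewrite lerDl sumr_ge0.
by rewrite -[F i]add0r lerD.
Qed.

(** Recovers the eliminated coordinate: [A] and [B] hold the lower and upper
    bounds on its displacement, and the bound [e] on their violation by a zero
    displacement also bounds the displacement that is needed. *)
Lemma interpolate (A B : seq R) (e : R) : 0 <= e ->
  (forall a b, a \in A -> b \in B -> a <= b) ->
  (forall a, a \in A -> a <= e) -> (forall b, b \in B -> - e <= b) ->
  exists2 t, `|t| <= e &
    (forall a, a \in A -> a <= t) /\ (forall b, b \in B -> t <= b).
Proof.
move=> e0 AB Ae Be; pose m := \big[Num.min/0]_(b <- B) b.
have em : - e <= m.
  by rewrite /m big_seq; apply: le_bigmin => //; rewrite oppr_le0.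
exists (\big[Num.max/m]_(a <- A) a); [rewrite ler_norml; apply/andP; split|split].
- exact: le_trans em (bigmax_ge_id _ _ _ _).
- rewrite big_seq; apply: bigmax_le => //.
  exact: le_trans (bigmin_le_id _ _ _ _) e0.
- by move=> a aA; exact: (@le_bigmax_seq _ _ _ A m a xpredT id).
- move=> b bB; rewrite big_seq; apply: bigmax_le => [|a aA]; last exact: AB.
  exact: (@ge_bigmin_seq _ _ _ B 0 b xpredT id).
Qed.

(** Dividing a form by this weight makes its [k]-th coefficient 0, 1 or -1, so
    that two forms with opposite coefficients can simply be added. *)
Definition fm_weight (k : 'I_n) l : R :=
  if l.1 0 k == 0 then 1 else `|l.1 0 k|.

Lemma fm_weight_gt0 k l : 0 < fm_weight k l.
Proof. by rewrite /fm_weight; case: eqP => // /eqP; rewrite normr_gt0. Qed.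

Definition fm_normalize k s : seq ('rV[R]_n * R) :=
  [seq (fm_weight k l)^-1 *: l | l <- s].

Definition fm_eliminate k s : seq ('rV[R]_n * R) :=
  let coef l := l.1 0 k in
  let t := fm_normalize k s in
  [seq l <- t | coef l == 0] ++
  [seq u + l | u <- [seq l <- t | coef l == 1], l <- [seq l <- t | coef l == -1]].

Lemma fm_normalize_coef k s l : l \in fm_normalize k s ->
  [\/ l.1 0 k = 0, l.1 0 k = 1 | l.1 0 k = -1].
Proof.
move=> /mapP[u _ ->] /=; rewrite mxE /fm_weight.
have [->|u0] := eqVneq (u.1 0 k) 0; first by constructor 1; rewrite mulr0.
have [u_gt0|u_le0] := ltP 0 (u.1 0 k).
  by constructor 2; rewrite gtr0_norm// mulVf.
by constructor 3; rewrite ler0_norm// invrN mulNr mulVf.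
Qed.

Lemma fm_eliminate_support k js s :
  (forall l, l \in s -> forall j, j \notin k :: js -> l.1 0 j = 0) ->
  forall l, l \in fm_eliminate k s -> forall j, j \notin js -> l.1 0 j = 0.
Proof.
move=> ss; have tt l : l \in fm_normalize k s ->
    forall j, j \notin k :: js -> l.1 0 j = 0.
  by move=> /mapP[u us ->] j jk /=; rewrite mxE (ss u)// mulr0.
move=> l ls j jjs; have [->|jk] := eqVneq j k; last first.
  have jkjs : j \notin k :: js by rewrite inE negb_or jk.
  move: ls; rewrite mem_cat => /orP[|/allpairsP[[a b] /= []]].
    by rewrite mem_filter => /andP[_ /tt]; apply.
  rewrite !mem_filter => /andP[_ at_] /andP[_ bt] -> /=.
  by rewrite mxE (tt a)// (tt b)// addr0.
move: ls; rewrite mem_cat => /orP[|/allpairsP[[a b] /= []]].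
  by rewrite mem_filter => /andP[/eqP].
rewrite !mem_filter => /andP[/eqP a1 _] /andP[/eqP b1 _] -> /=.
by rewrite mxE a1 b1 subrr.
Qed.

Lemma fm_normalize_le k s x r : 0 <= r ->
  (forall l, l \in s -> aeval l x <= r) ->
  forall l, l \in fm_normalize k s ->
    aeval l x <= (\sum_(l <- s) (fm_weight k l)^-1) * r.
Proof.
move=> r0 sx _ /mapP[l ls ->]; rewrite aevalZ.
have w0 l' : 0 <= (fm_weight k l')^-1 by rewrite invr_ge0 ltW ?fm_weight_gt0.
apply: (@le_trans _ _ ((fm_weight k l)^-1 * r)); first by rewrite ler_wpM2l ?sx.
by rewrite ler_wpM2r //; apply: (ler_sum_mem (F := fun l => (fm_weight k l)^-1)).
Qed.

Lemma fm_normalize_le0 k s x :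
  (forall l, l \in fm_normalize k s -> aeval l x <= 0) ->
  forall l, l \in s -> aeval l x <= 0.
Proof.
move=> tx l ls; have := tx _ (map_f (fun l => (fm_weight k l)^-1 *: l) ls).
by rewrite aevalZ pmulr_rle0 // invr_gt0 fm_weight_gt0.
Qed.

(** The eliminated system consists of nonnegative combinations of the original
    one, so it is violated by at most a constant multiple. *)
Lemma fm_eliminate_le k s x r : 0 <= r ->
  (forall l, l \in s -> aeval l x <= r) ->
  forall l, l \in fm_eliminate k s ->
    aeval l x <= 2 * ((\sum_(l <- s) (fm_weight k l)^-1) * r).
Proof.
move=> r0 sx l; have tx := fm_normalize_le (k := k) r0 sx.
have M0 : 0 <= \sum_(l <- s) (fm_weight k l)^-1.
  by apply: sumr_ge0 => i _; rewrite invr_ge0 ltW ?fm_weight_gt0.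
have Mr := mulr_ge0 M0 r0.
rewrite mem_cat => /orP[|/allpairsP[[a b] /= []]].
  by rewrite mem_filter => /andP[_ /tx]; lra.
rewrite !mem_filter => /andP[_ /tx ax] /andP[_ /tx bx] ->.
rewrite aevalD; lra.
Qed.

(** Induction on the list [js] of coordinates that occur in the system.  The
    induction hypothesis moves [x] to a point [y'] satisfying the system with
    the coordinate [k] eliminated; this is what makes the lower bounds on that
    coordinate at [y'] compatible with the upper ones, and since [y'] is close
    to [x] the old value of the coordinate nearly satisfies them. *)
Lemma hoffman_support (js : seq 'I_n) s :
  (forall l, l \in s -> forall j, j \notin js -> l.1 0 j = 0) ->
  (exists x, forall l, l \in s -> aeval l x <= 0) ->
  exists2 C, 0 <= C & forall x r, 0 <= r ->
    (forall l, l \in s -> aeval l x <= r) ->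
    exists2 y, near_pt (C * r) x y & forall l, l \in s -> aeval l y <= 0.
Proof.
elim: js s => [|k js ih] s ss [x0 sx0].
  exists 0 => // x r r0 sx; exists x; first by move=> j; rewrite subrr normr0 mul0r.
  move=> l ls; apply: le_trans (sx0 l ls); rewrite /aeval lerD2r.
  by apply/ler_sum => j _; rewrite (ss l ls)// !mul0r.
have [|C C0 hC] := ih (fm_eliminate k s) (fm_eliminate_support ss).
  exists x0 => l /(fm_eliminate_le (lexx 0) sx0); rewrite !mulr0; exact.
set t := fm_normalize k s.
set M := \sum_(l <- s) (fm_weight k l)^-1.
have M0 : 0 <= M.
  by apply: sumr_ge0 => l _; rewrite invr_ge0 ltW ?fm_weight_gt0.
set N := \sum_(l <- t) slope l.
have N0 : 0 <= N by apply: sumr_ge0 => l _; exact: slope_ge0.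
pose D := C * (2 * M).
have D0 : 0 <= D by rewrite !mulr_ge0.
exists (D + (M + N * D)); first by rewrite !addr_ge0 // mulr_ge0.
move=> x r r0 sx; have Mr0 : 0 <= M * r by rewrite mulr_ge0.
have [|y' xy' ey'] := hC x (2 * (M * r)) _ (fm_eliminate_le r0 sx).
  by rewrite mulr_ge0.
have {}xy' : near_pt (D * r) x y' by rewrite /D -!mulrA.
(* [z] is [y'] with the [k]-th coordinate of [x] put back; the forms of the
   eliminated system do not see the difference. *)
pose z := y' + (x 0 k - y' 0 k) *: delta_mx 0 k.
have zE j : z 0 j = if j == k then x 0 k else y' 0 j.
  rewrite !mxE eqxx /=; case: eqP => [->|_]; last by rewrite mulr0 addr0.
  by rewrite mulr1 addrC subrK.
have xz : near_pt (D * r) x z.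
  move=> j; rewrite zE; case: eqP => [->|_]; last exact: xy'.
  by rewrite subrr normr0 mulr_ge0.
have tz l : l \in t -> aeval l z <= M * r + N * (D * r).
  move=> lt; apply: le_trans (aeval_lipschitz l (near_pt_sym xz)) _.
  rewrite lerD ?(fm_normalize_le r0 sx)// ler_wpM2r ?mulr_ge0//.
  exact: (ler_sum_mem slope_ge0).
have [|||| d dr [dL dU]] := @interpolate
    [seq aeval l z | l : 'rV[R]_n * R <- t & l.1 0 k == -1]
    [seq - aeval l z | l : 'rV[R]_n * R <- t & l.1 0 k == 1] (M * r + N * (D * r)).
- by rewrite addr_ge0 // !mulr_ge0.
- move=> a b /mapP[l + ->] /mapP[u + ->] => lL uU.
  rewrite -subr_ge0 -opprD oppr_ge0 -aevalD.
  have ul : u + l \in fm_eliminate k s.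
    by rewrite mem_cat (allpairs_f +%R) ?orbT.
  rewrite aeval_move.
  move: lL uU; rewrite !mem_filter => /andP[/eqP lk _] /andP[/eqP uk _].
  by rewrite /= mxE uk lk subrr mulr0 addr0 ey'.
- by move=> a /mapP[l + ->]; rewrite mem_filter => /andP[_ /tz].
- by move=> a /mapP[l + ->]; rewrite mem_filter lerN2 => /andP[_ /tz].
exists (z + d *: delta_mx 0 k).
  move=> j; rewrite mxE zE !mxE eqxx /=; case: eqP => [->|_].
    rewrite mulr1 opprD addrA subrr sub0r normrN mulrDl mulrDl mulrA in dr *.
    by apply: le_trans dr _; rewrite lerDr mulr_ge0.
  rewrite mulr0 addr0 mulrDl; apply: le_trans (xy' j) _.
  by rewrite lerDl mulr_ge0 // addr_ge0 // mulr_ge0.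
apply: (@fm_normalize_le0 k) => l lt; rewrite aeval_move.
case: (fm_normalize_coef lt) => lk; rewrite lk.
- rewrite mulr0 addr0 aeval_move lk mulr0 addr0 ey' //.
  by rewrite mem_cat mem_filter lk eqxx lt.
- rewrite mulr1 -subr_ge0 sub0r opprD subr_ge0 dU //.
  by apply: (map_f (fun l => - aeval l z)); rewrite mem_filter lk eqxx.
- rewrite mulrN1 subr_le0 dL //.
  by apply: (map_f (fun l => aeval l z)); rewrite mem_filter lk eqxx.
Qed.

(** Hoffman's error bound: once every coordinate is eliminated only constants
    remain, and feasibility makes these nonpositive. *)
Lemma hoffman s :
  (exists x, forall l, l \in s -> aeval l x <= 0) ->
  exists2 C, 0 <= C & forall x r, 0 <= r ->
    (forall l, l \in s -> aeval l x <= r) ->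
    exists2 y, near_pt (C * r) x y & forall l, l \in s -> aeval l y <= 0.
Proof.
by apply: (@hoffman_support (enum 'I_n)) => l _ j; rewrite mem_enum.
Qed.

End Hoffman.

(** * Finite unions of rational polyhedra *)

Section PolyhedralUnion.
Variables (R : realType) (n : nat).
Implicit Types (l : 'rV[rat]_n * R) (x : 'rV[R]_n) (V W : set 'rV[R]_n).
Implicit Types (P Q : seq ('rV[rat]_n * R)).

Definition realform l : 'rV[R]_n * R := (map_mx ratr l.1, l.2).

Definition qeval l x : R := aeval (realform l) x.

Lemma qevalD l1 l2 x : qeval (l1 + l2) x = qeval l1 x + qeval l2 x.
Proof. by rewrite /qeval -aevalD /realform /= map_mxD. Qed.

Lemma qevalB l1 l2 x : qeval (l1 - l2) x = qeval l1 x - qeval l2 x.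
Proof. by apply/eqP; rewrite -subr_eq opprK -qevalD subrK. Qed.

(** A disjunction of conjunctions of inequalities, as a list of lists: closure
    under intersection is then distributivity. *)
Definition polyhedral_union V : Prop :=
  exists s : seq (seq ('rV[rat]_n * R)),
    forall x, V x <-> has (all (fun l => qeval l x <= 0)) s.

Lemma polyhedral_ext V W :
  (forall x, V x <-> W x) -> polyhedral_union V -> polyhedral_union W.
Proof. by move=> VW [s sV]; exists s => x; rewrite -VW. Qed.

Lemma polyhedralT : polyhedral_union setT.
Proof. by exists [:: [::]] => x. Qed.

Lemma polyhedral0 : polyhedral_union set0.
Proof. by exists [::] => x. Qed.

Lemma polyhedralU V W :
  polyhedral_union V -> polyhedral_union W -> polyhedral_union (V `|` W).
Proof.
move=> [s sV] [t tW]; exists (s ++ t) => x; rewrite has_cat.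
by split=> [[/sV ->//|/tW ->]|/orP[/sV|/tW]]; [rewrite orbT|left|right].
Qed.

Lemma polyhedralI V W :
  polyhedral_union V -> polyhedral_union W -> polyhedral_union (V `&` W).
Proof.
move=> [s sV] [t tW]; exists [seq P ++ Q | P <- s, Q <- t] => x; split.
  move=> [/sV/hasP[P Ps Px] /tW/hasP[Q Qt Qx]]; apply/hasP; exists (P ++ Q).
    exact: allpairs_f.
  by rewrite all_cat Px.
move=> /hasP[_ /allpairsP[[P Q] /= [Ps Qt ->]]].
rewrite all_cat => /andP[Px Qx]; split; first by apply/sV/hasP; exists P.
by apply/tW/hasP; exists Q.
Qed.

Lemma polyhedral_le l1 l2 : polyhedral_union [set x | qeval l1 x <= qeval l2 x].
Proof. by exists [:: [:: l1 - l2]] => x /=; rewrite orbF andbT qevalB subr_le0. Qed.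

Lemma rational_polyhedralP V : rational_polyhedral V <->
  exists P, forall x, V x <-> all (fun l => qeval l x <= 0) P.
Proof.
split=> [[m [c [a ->]]]|[P PV]].
  exists [seq (row i c, a i) | i <- enum 'I_m] => x; rewrite all_map.
  have E i : qeval (row i c, a i) x = \sum_(j < n) map_mx ratr c i j * x 0 j + a i.
    by rewrite /qeval /aeval; congr (_ + _); apply: eq_bigr => j _; rewrite !mxE.
  split=> [h|/allP h i]; first by apply/allP => i _ /=; rewrite E; exact: h.
  by rewrite -E; apply: h; rewrite mem_enum.
exists (size P), (\matrix_(i, j) (nth 0 P i).1 0 j), (fun i => (nth 0 P i).2).
apply/seteqP; split=> x.
  move=> /PV/allP h i; have := h _ (mem_nth 0 (ltn_ord i)).
  rewrite /qeval /aeval /=; congr (_ + _ <= 0).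
  by apply: eq_bigr => j _; rewrite !mxE.
move=> h; apply/PV/(all_nthP 0) => i iP; have := h (Ordinal iP).
rewrite /qeval /aeval /=; congr (_ + _ <= 0).
by apply: eq_bigr => j _; rewrite !mxE.
Qed.

Lemma polyhedral_unionP V : polyhedral_union V <->
  exists (k : nat) (P : 'I_k -> set 'rV[R]_n),
    (forall i, rational_polyhedral (P i)) /\ V = \bigcup_i P i.
Proof.
split=> [[s sV]|[k [P [Ppol ->]]]].
  exists (size s), (fun i => [set x | all (fun l => qeval l x <= 0) (nth [::] s i)]).
  split=> [i|]; first by apply/rational_polyhedralP; exists (nth [::] s i).
  apply/seteqP; split=> x; last first.
    move=> [i _ ix]; apply/sV/hasP; exists (nth [::] s i) => //.
    exact: mem_nth.
  by move=> /sV/(has_nthP [::])[i ik ix]; exists (Ordinal ik).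
have /choice[L LP] i := (rational_polyhedralP (P i)).1 (Ppol i).
exists [seq L i | i <- enum 'I_k] => x; rewrite has_map; split.
  by move=> [i _ /LP ix]; apply/hasP; exists i => //; rewrite mem_enum.
by move=> /hasP[i _ /LP ix]; exists i.
Qed.

End PolyhedralUnion.

(** * The tropical order *)

Section TropicalOrder.
Variable R : realType.
Implicit Types a b c d : trop R.

(** The order of the idempotent semiring. Formulating bounds with it treats the
    value -oo on the same footing as the real values. *)
Definition tle a b : Prop := a + b = b.

Lemma tle_Some (r s : R) : tle (Some r) (Some s) <-> r <= s.
Proof.
rewrite /tle /GRing.add /=; split=> [[]|/max_idPr -> //].
by move=> <-; rewrite le_max lexx.
Qed.

Lemma tadd_idem a : a + a = a.
Proof. by case: a => // r; congr Some; rewrite maxxx. Qed.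

Lemma tle_refl a : tle a a. Proof. exact: tadd_idem. Qed.

Lemma tle_trans b a c : tle a b -> tle b c -> tle a c.
Proof. by rewrite /tle => ab <-; rewrite addrA ab. Qed.

Lemma tle_anti a b : tle a b -> tle b a -> a = b.
Proof. by rewrite /tle => <-; rewrite addrC addrA tadd_idem addrC. Qed.

Lemma tleD a b c d : tle a b -> tle c d -> tle (a + c) (b + d).
Proof. by rewrite /tle addrACA => -> ->. Qed.

Lemma tle_addl a b : tle a (a + b).
Proof. by rewrite /tle addrA tadd_idem. Qed.

Lemma tleM a b c d : tle a b -> tle c d -> tle (a * c) (b * d).
Proof.
move=> ab cd; apply: (@tle_trans (b * c)); rewrite /tle.
  by rewrite -mulrDl ab.
by rewrite -mulrDr cd.
Qed.

Lemma tle_addl_iff a b c : tle (a + b) c <-> tle a c /\ tle b c.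
Proof.
split=> [h|[ac bc]]; last by rewrite -[c]tadd_idem; exact: tleD.
split; first exact: tle_trans (tle_addl a b) h.
by apply: tle_trans h; rewrite addrC; exact: tle_addl.
Qed.

Lemma tle_total a b : tle a b \/ tle b a.
Proof.
case: a b => [a|] [b|]; try by [left|right].
by case: (leP a b) => [|/ltW] /tle_Some; [left|right].
Qed.

Lemma tle_addr_iff a b c : tle c (a + b) <-> tle c a \/ tle c b.
Proof.
split=> [|[h|h]]; last 2 first.
- exact: tle_trans h (tle_addl _ _).
- by apply: tle_trans h _; rewrite [a + b]addrC; exact: tle_addl.
by have [/[dup] + ->|] := tle_total a b; [right|rewrite /tle addrC => ->; left].
Qed.

(** Bounding each of [a], [b] by the other excludes that just one of them is
    -oo, a case where inversion would not reverse the order. *)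
Lemma tle_inv a b (r : R) : tle a (b * Some r) -> tle b (a * Some r) ->
  tle (tinv b) (tinv a * Some r).
Proof.
case: a b => [a|] [b|] // /tle_Some ab /tle_Some ba; apply/tle_Some.
by rewrite lerNl opprD opprK lerBlDr.
Qed.

Lemma tmul_Some (r s : R) : (Some r : trop R) * Some s = Some (r + s).
Proof. by []. Qed.

Lemma tle_eps a b : (forall e, 0 < e -> tle a (b * Some e)) -> tle a b.
Proof.
case: a b => [a|] [b|] h; rewrite /tle //; last by have := h 1 ltr01.
by apply/tle_Some/ler_addgt0Pr => e /h/tle_Some.
Qed.

End TropicalOrder.

(** * Tropical polynomials as maxima of affine forms *)

Section MaxAffine.
Variables (R : realType) (n : nat).
Implicit Types (l : 'rV[rat]_n * R) (x y : 'rV[R]_n) (F G : 'rV[R]_n -> trop R).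
Implicit Types (p q : tpolyfun R n) (f g : tratfun R n).

Definition max_affine F : Prop :=
  exists s : seq ('rV[rat]_n * R),
    forall x, F x = \sum_(l <- s) (Some (qeval l x) : trop R).

Lemma max_affine0 : max_affine (fun=> 0).
Proof. by exists [::] => x; rewrite big_nil. Qed.

Lemma max_affine_cst a : max_affine (fun=> a).
Proof.
case: a => [r|]; last exact: max_affine0.
exists [:: (0, r)] => x; rewrite big_seq1 /qeval /aeval /= big1 ?add0r// => j _.
by rewrite !mxE rmorph0 mul0r.
Qed.

Lemma max_affine_coord (j : 'I_n) : max_affine (fun x => finpt x j).
Proof.
exists [:: (delta_mx 0 j, 0)] => x; rewrite big_seq1 /qeval /aeval /= addr0.
rewrite (bigD1 j)//= !mxE !eqxx rmorph1 mul1r big1 ?addr0// => i ij.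
by rewrite !mxE (negPf ij) andbF rmorph0 mul0r.
Qed.

Lemma max_affineD F G :
  max_affine F -> max_affine G -> max_affine (fun x => F x + G x).
Proof. by move=> [s sF] [t tG]; exists (s ++ t) => x; rewrite big_cat sF tG. Qed.

Lemma max_affineM F G :
  max_affine F -> max_affine G -> max_affine (fun x => F x * G x).
Proof.
move=> [s sF] [t tG]; exists [seq l + m | l <- s, m <- t] => x.
rewrite sF tG mulr_suml big_allpairs_dep /=; apply: eq_bigr => l _.
by rewrite mulr_sumr; apply: eq_bigr => m _; rewrite qevalD.
Qed.

Lemma max_affine_pfeval p : max_affine (fun x => pfeval (finpt x) p).
Proof.
rewrite /pfeval /teval; elim: (finsupp (repr p) : seq _) => [|m s ih].
  by under [X in max_affine X]funext do rewrite big_nil; exact: max_affine0.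
under [X in max_affine X]funext do rewrite big_cons.
apply: max_affineD ih; apply: max_affineM; first exact: max_affine_cst.
elim: (index_enum _) => [|i r ih].
  under [X in max_affine X]funext do rewrite big_nil; exact: max_affine_cst.
under [X in max_affine X]funext do rewrite big_cons.
apply: max_affineM ih; elim: (m i) => [|k ih].
  under [X in max_affine X]funext do rewrite expr0; exact: max_affine_cst.
under [X in max_affine X]funext do rewrite exprS.
by apply: max_affineM ih; exact: max_affine_coord.
Qed.

(** A maximum of [l]'s is at most a maximum of [m]'s when each [l] is below some
    [m]: an intersection of unions of half-spaces. *)
Lemma polyhedral_tle F G : max_affine F -> max_affine G ->
  polyhedral_union [set x | tle (F x) (G x)].
Proof.
move=> [s sF] [t tG]; under eq_set do rewrite sF tG.
pose T x : trop R := \sum_(m <- t) (Some (qeval m x) : trop R).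
rewrite -/(T _); elim: s {sF} => [|l s ih].
  apply: polyhedral_ext (@polyhedralT R n) => x; split=> // _.
  by rewrite /= big_nil /tle add0r.
have /polyhedralI : polyhedral_union [set x | tle (Some (qeval l x)) (T x)].
  rewrite /T; elim: t {tG T ih} => [|m t ih].
    apply: polyhedral_ext (@polyhedral0 R n) => x; split=> //=.
    by rewrite big_nil /tle addr0.
  apply: polyhedral_ext (polyhedralU (polyhedral_le l m) ih) => x /=.
  by rewrite big_cons tle_addr_iff tle_Some.
move=> /(_ _ ih); apply: polyhedral_ext => x /=.
by rewrite big_cons tle_addl_iff.
Qed.

Lemma polyhedral_equalizer f g :
  polyhedral_union [set x | rfeval x f = rfeval x g].
Proof.
pose F x := pfeval (finpt x) (rfnum f * rfden g).
pose G x := pfeval (finpt x) (rfnum g * rfden f).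
have -> : [set x | rfeval x f = rfeval x g] =
    [set x | tle (F x) (G x)] `&` [set x | tle (G x) (F x)].
  have E x : rfeval x f = rfeval x g <-> F x = G x.
    by rewrite /F /G !pfevalM; apply: tdivP; apply/pfeval_neq0/rfden_neq0.
  apply/seteqP; split=> x /=; first by move=> /E ->; split; exact: tle_refl.
  by move=> [FG GF]; apply/E/tle_anti.
by apply: polyhedralI; apply: polyhedral_tle; exact: max_affine_pfeval.
Qed.

(** Stated multiplicatively, so that it covers the function -oo too. *)
Definition tlipschitz F : Prop :=
  exists2 L : R, 0 <= L & forall d x y, 0 <= d -> near_pt d x y ->
    tle (F x) (F y * Some (L * d)).

Lemma tlipschitz_max_affine F : max_affine F -> tlipschitz F.
Proof.
move=> [s sF]; exists (\sum_(l <- s) slope (realform l)).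
  by apply: sumr_ge0 => l _; exact: slope_ge0.
move=> d x y d0 xy; rewrite !sF mulr_suml.
have : {subset s <= s} by [].
elim: {1 3 4}s => [|l r ih] rs; first by rewrite !big_nil; exact: tle_refl.
rewrite !big_cons; apply: tleD; last first.
  by apply: ih => m mr; apply: rs; rewrite inE mr orbT.
apply/tle_Some; apply: le_trans (aeval_lipschitz _ xy) _.
rewrite lerD2l ler_wpM2r//.
apply: (ler_sum_mem (F := fun l => slope (realform l))) => [m|].
  exact: slope_ge0.
by apply: rs; rewrite mem_head.
Qed.

Lemma tlipschitz_rfeval f : tlipschitz (fun x => rfeval x f).
Proof.
have [L L0 hL] := tlipschitz_max_affine (max_affine_pfeval (rfnum f)).
have [M M0 hM] := tlipschitz_max_affine (max_affine_pfeval (rfden f)).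
exists (L + M); first exact: addr_ge0.
move=> d x y d0 xy; have yx := near_pt_sym xy.
rewrite /rfeval mulrDl -tmul_Some mulrACA.
by apply: tleM; [exact: hL|apply: tle_inv; exact: hM].
Qed.

(** Compare [f x] with [f y], which is [g y], and that with [g x]. *)
Lemma agree_nearby f g :
  exists2 L : R, 0 <= L & forall d x y, 0 <= d -> near_pt d x y ->
    rfeval y f = rfeval y g -> tle (rfeval x f) (rfeval x g * Some (L * d)).
Proof.
have [L L0 hL] := tlipschitz_rfeval f; have [M M0 hM] := tlipschitz_rfeval g.
exists (M + L); first exact: addr_ge0.
move=> d x y d0 xy fg; apply: tle_trans (hL _ _ _ d0 xy) _.
rewrite fg mulrDl -tmul_Some mulrA; apply: tleM (tle_refl _).
exact/hM/near_pt_sym.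
Qed.

End MaxAffine.

(** * Passing to the closure *)

Section Closure.
Variables (R : realType) (n : nat).
Implicit Types (x y : 'rV[R]_n) (V : set 'rV[R]_n) (f g : tratfun R n).

Lemma closure_near V x : closure V x <->
  forall e, 0 < e -> exists2 y, V y & forall j, `|x 0 j - y 0 j| < e.
Proof.
split=> [h e e0|h B /nbhs_ballP[e /= e0 eB]].
  have [y [Vy [_ xy]]] := h _ (nbhsx_ballx x e e0).
  by exists y => // j; exact: xy.
have [y Vy xy] := h e e0; exists y; split=> //; apply: eB; split=> // i j.
by rewrite ord1; exact: xy.
Qed.

(** A point of the closure has points of [V] at arbitrarily small distance, and
    there [agree_nearby] leaves an arbitrarily small discrepancy. *)
Lemma EV_closure V : EV (closure V) = EV V.
Proof.
apply/seteqP; split=> -[f g] fg x Vx; first exact/fg/subset_closure.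
have le f' g' : (forall y, V y -> rfeval y f' = rfeval y g') ->
    tle (rfeval x f') (rfeval x g').
  move=> fg'; have [L L0 hL] := agree_nearby f' g'.
  apply: tle_eps => e e0.
  have e1 : 0 < e / (L + 1) by rewrite divr_gt0// ltr_wpDl.
  have [y Vy xy] := (closure_near V x).1 Vx _ e1.
  have xy' : near_pt (e / (L + 1)) x y by move=> j; exact/ltW/xy.
  apply: tle_trans (hL _ x y (ltW e1) xy' (fg' y Vy)) _.
  apply: tleM (tle_refl _) _; apply/tle_Some; rewrite mulrCA ger_pMr//.
  by rewrite ler_pdivrMr ?mul1r ?lerDl// ltr_wpDl.
by apply: tle_anti; apply: le => y /fg.
Qed.

End Closure.

(** * Real functions realised by tropical rational functions *)

Section Tropical.
Variables (R : realType) (n : nat).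
Implicit Types (x y : 'rV[R]_n) (V : set 'rV[R]_n) (f g : tratfun R n).
Implicit Types (phi psi : 'rV[R]_n -> R).

Definition tropical phi : Prop :=
  exists f : tratfun R n, forall x, rfeval x f = Some (phi x).

Lemma tropical_ext phi psi : phi =1 psi -> tropical phi -> tropical psi.
Proof. by move=> /funext ->. Qed.

Lemma tropical_monomial (a : trop R) (m : {ffun 'I_n -> nat}) :
  exists f : tratfun R n,
    forall x, rfeval x f = a * \prod_i finpt x i ^+ m i.
Proof.
pose p : tpoly R n := [fsfun k in [fset m]%fset => a].
exists (mkfrac (\pi_(tpolyfun R n)%qT p) (oner_neq0 (tpolyfun R n))) => x.
rewrite rfeval_mkfrac pfeval1 pfeval_pi teval_fsfun big_seq_fset1.
by rewrite -[RHS](tinvK _ (b := 1)) ?mulr1.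
Qed.

Lemma tropical_cst (r : R) : tropical (fun=> r).
Proof.
have [f fE] := tropical_monomial (Some r) 0; exists f => x.
by rewrite fE big1 ?mulr1// => i _; rewrite ffunE expr0.
Qed.

Lemma tropical_coord (j : 'I_n) : tropical (fun x => x 0 j).
Proof.
have [f fE] := tropical_monomial 1 [ffun i => (i == j : nat)]; exists f => x.
rewrite fE mul1r (bigD1 j)//= ffunE eqxx expr1 big1 ?mulr1// => i ij.
by rewrite ffunE (negPf ij) expr0.
Qed.

Lemma tropical_max phi psi : tropical phi -> tropical psi ->
  tropical (fun x => Num.max (phi x) (psi x)).
Proof. by move=> [f fE] [g gE]; exists (f + g) => x; rewrite rfevalD fE gE. Qed.

Lemma tropicalD phi psi : tropical phi -> tropical psi ->
  tropical (fun x => phi x + psi x).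
Proof. by move=> [f fE] [g gE]; exists (f * g) => x; rewrite rfevalM fE gE. Qed.

Lemma tropicalN phi : tropical phi -> tropical (fun x => - phi x).
Proof.
move=> [f fE]; have [|g fg] := @tratfun_divisible R n f.
  by apply/eqP => f0; have := fE 0; rewrite f0 rfeval0.
exists g => x; have := rfeval1 x; rewrite -fg rfevalM fE.
by case: (rfeval x g) => // r [/eqP]; rewrite addrC addr_eq0 => /eqP ->.
Qed.

Lemma tropical_min phi psi : tropical phi -> tropical psi ->
  tropical (fun x => Num.min (phi x) (psi x)).
Proof.
move=> /tropicalN tphi /tropicalN tpsi.
apply: tropical_ext (tropicalN (tropical_max tphi tpsi)) => x.
by rewrite -oppr_min opprK.
Qed.

Lemma tropical_mulrn phi (k : nat) :
  tropical phi -> tropical (fun x => k%:R * phi x).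
Proof.
move=> tphi; elim: k => [|k ih].
  by apply: tropical_ext (tropical_cst 0) => x; rewrite mul0r.
by apply: tropical_ext (tropicalD tphi ih) => x; rewrite mulrS mulrDl mul1r.
Qed.

Lemma tropical_mulrz phi (k : int) :
  tropical phi -> tropical (fun x => k%:~R * phi x).
Proof.
move=> tphi; case: k => k; first exact: tropical_mulrn.
apply: tropical_ext (tropicalN (tropical_mulrn k.+1 tphi)) => x.
by rewrite NegzE mulrNz mulNr.
Qed.

(** Affine forms with rational slopes are tropical only after clearing
    denominators; this weaker notion is still closed under sums, maxima and
    minima. *)
Definition rationally_tropical phi : Prop :=
  exists2 D : nat, (0 < D)%N & tropical (fun x => D%:R * phi x).

Lemma rationally_tropical_of phi : tropical phi -> rationally_tropical phi.
Proof. by move=> ?; exists 1%N; last exact: tropical_mulrn. Qed.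

Lemma rationally_tropicalD phi psi :
  rationally_tropical phi -> rationally_tropical psi ->
  rationally_tropical (fun x => phi x + psi x).
Proof.
move=> [D D0 tphi] [E E0 tpsi]; exists (D * E)%N; first by rewrite muln_gt0 D0.
have := tropicalD (tropical_mulrn E tphi) (tropical_mulrn D tpsi).
apply: tropical_ext => x.
by rewrite natrM; ring.
Qed.

Lemma rationally_tropical_max phi psi :
  rationally_tropical phi -> rationally_tropical psi ->
  rationally_tropical (fun x => Num.max (phi x) (psi x)).
Proof.
move=> [D D0 tphi] [E E0 tpsi]; exists (D * E)%N; first by rewrite muln_gt0 D0.
have := tropical_max (tropical_mulrn E tphi) (tropical_mulrn D tpsi).
apply: tropical_ext => x.
by rewrite natrM maxr_pMr ?mulr_ge0//; congr (Num.max _ _); ring.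
Qed.

Lemma rationally_tropical_min phi psi :
  rationally_tropical phi -> rationally_tropical psi ->
  rationally_tropical (fun x => Num.min (phi x) (psi x)).
Proof.
move=> [D D0 tphi] [E E0 tpsi]; exists (D * E)%N; first by rewrite muln_gt0 D0.
have := tropical_min (tropical_mulrn E tphi) (tropical_mulrn D tpsi).
apply: tropical_ext => x.
by rewrite natrM minr_pMr ?mulr_ge0//; congr (Num.min _ _); ring.
Qed.

Lemma rationally_tropical_ratr (q : rat) (j : 'I_n) :
  rationally_tropical (fun x => ratr q * x 0 j).
Proof.
exists `|denq q|%N; first by rewrite absz_gt0.
apply: tropical_ext (tropical_mulrz (numq q) (tropical_coord j)) => x.
have d0 : (denq q)%:~R != 0 :> R by rewrite intr_eq0 denq_neq0.
have -> : (`|denq q|%N)%:R = (denq q)%:~R :> R by rewrite -[in RHS]absz_denq.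
by rewrite mulrA /ratr [_ / _]mulrC mulVKf.
Qed.

Lemma rationally_tropical_qeval (l : 'rV[rat]_n * R) :
  rationally_tropical (qeval l).
Proof.
apply: (@rationally_tropicalD (fun x => \sum_j (realform l).1 0 j * x 0 j)
  (fun=> l.2)); last exact/rationally_tropical_of/tropical_cst.
elim: (index_enum _) => [|j r ih].
  under [X in rationally_tropical X]funext do rewrite big_nil.
  exact/rationally_tropical_of/tropical_cst.
under [X in rationally_tropical X]funext do rewrite big_cons mxE.
exact: rationally_tropicalD (rationally_tropical_ratr _ _) ih.
Qed.

Lemma rationally_tropical_bigmax (I : Type) (r : seq I) (phi : 'rV[R]_n -> R)
    (F : I -> 'rV[R]_n -> R) :
  rationally_tropical phi -> (forall i, rationally_tropical (F i)) ->
  rationally_tropical (fun x => \big[Num.max/phi x]_(i <- r) F i x).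
Proof.
move=> phiT FT; elim: r => [|i r ih].
  by under [X in rationally_tropical X]funext do rewrite big_nil.
under [X in rationally_tropical X]funext do rewrite big_cons.
exact: rationally_tropical_max.
Qed.

Lemma rationally_tropical_bigmin (I : Type) (r : seq I) (phi : 'rV[R]_n -> R)
    (F : I -> 'rV[R]_n -> R) :
  rationally_tropical phi -> (forall i, rationally_tropical (F i)) ->
  rationally_tropical (fun x => \big[Num.min/phi x]_(i <- r) F i x).
Proof.
move=> phiT FT; elim: r => [|i r ih].
  by under [X in rationally_tropical X]funext do rewrite big_nil.
under [X in rationally_tropical X]funext do rewrite big_cons.
exact: rationally_tropical_min.
Qed.

End Tropical.

(** * From finite generation to polyhedra *)

Section Forward.
Variables (R : realType) (n : nat).
Implicit Types (x y : 'rV[R]_n) (V : set 'rV[R]_n) (f g : tratfun R n).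

(** The tent [max 0 (e - dist x y)] for the l1 distance, where [V] stays at sup
    distance, hence at l1 distance, at least [e] from [x]. *)
Lemma bump V x : ~ closure V x ->
  exists2 f, EV V (f, 1) & rfeval x f <> 1.
Proof.
move=> /closure_near/existsNP[e /not_implyP[e0 eV]].
pose phi (y : 'rV[R]_n) : R :=
  Num.max 0 (e - \sum_j Num.max (y 0 j - x 0 j) (x 0 j - y 0 j)).
have [f fE] : tropical phi.
  apply: tropical_max (tropical_cst _ _) _; apply: tropicalD (tropical_cst _ _) _.
  apply: tropicalN; elim: (index_enum _) => [|j r ih].
    by under [X in tropical X]funext do rewrite big_nil; exact: tropical_cst.
  under [X in tropical X]funext do rewrite big_cons.
  apply: tropicalD ih; apply: tropical_max.
    exact: tropicalD (tropical_coord _ _) (tropical_cst _ _).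
  by apply: tropicalD (tropical_cst _ _) _; apply/tropicalN/tropical_coord.
have maxE (y : 'rV[R]_n) j :
    Num.max (y 0 j - x 0 j) (x 0 j - y 0 j) = `|x 0 j - y 0 j|.
  by rewrite -(opprB (x 0 j) (y 0 j)) maxC maxrN.
exists f => [y Vy /=|]; rewrite fE ?rfeval1.
  congr Some; apply/max_idPl; rewrite subr_le0.
  have [j] : exists j, e <= `|x 0 j - y 0 j|.
    apply: contrapT => /forallNP h; apply: eV; exists y => // j.
    by rewrite ltNge; apply/negP/h.
  move=> /le_trans; apply; under eq_bigr do rewrite maxE.
  by rewrite (bigD1 j) //= lerDl sumr_ge0.
case; apply/eqP; rewrite gt_eqF// /phi big1 => [|j _]; last first.
  by rewrite subrr maxxx.
by rewrite subr0 lt_max e0 orbT.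
Qed.

(** Evaluation at a common equalizing point of [F] defines a congruence
    containing [F], hence all of [EV V]; a tent function would contradict this
    outside the closure. *)
Lemma closure_generators V (F : set (tratfun R n * tratfun R n)) :
  F `<=` EV V -> EV V = smallest (@congruence _) F ->
  closure V = [set x | forall fg, F fg -> rfeval x fg.1 = rfeval x fg.2].
Proof.
move=> FV VF; apply/seteqP; split=> [x Vx fg /FV|x Fx].
  by rewrite -EV_closure; apply.
apply: contrapT => /bump[f fV]; apply.
have : EV [set x] (f, 1).
  move: fV; rewrite VF; apply; split; first exact: EV_congruence.
  by move=> fg Ffg y ->; exact: Fx.
by move=> /(_ x erefl) /= ->; rewrite rfeval1.
Qed.

Lemma fg_polyhedral V : fg_congruence (EV V) -> polyhedral_union (closure V).
Proof.
move=> [F [/finite_seqP[s ->] FV VF]]; rewrite (closure_generators FV VF).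
elim: s {FV VF} => [|[f g] s ih].
  by apply: polyhedral_ext (@polyhedralT R n) => x; split.
apply: polyhedral_ext (polyhedralI (polyhedral_equalizer f g) ih) => x /=.
split=> [[fgx sx] fg|h].
  by rewrite inE => /predU1P[->//|/sx].
split=> [|fg fgs]; first by apply: (h (f, g)); rewrite mem_head.
by apply: h; rewrite inE fgs orbT.
Qed.

End Forward.

(** * From polyhedra to a single generator *)

Section Backward.
Variables (R : realType) (n : nat).
Implicit Types (x y : 'rV[R]_n) (V : set 'rV[R]_n) (f g h : tratfun R n).
Implicit Types (P : seq ('rV[rat]_n * R)) (s : seq (seq ('rV[rat]_n * R))).

(** Both hypotheses are inequalities of the idempotent order. As [h ^+ k] is
    identified with [1], they give that [f + g] is identified with [g] and
    with [f]. *)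
Lemma congruence_sandwich (E : set (tratfun R n * tratfun R n)) h f g k :
  congruence E -> E (h, 1) ->
  f + g * h ^+ k = g * h ^+ k -> g + f * h ^+ k = f * h ^+ k -> E (f, g).
Proof.
move=> cE Eh fg gf.
have Ehk : E (h ^+ k, 1).
  elim: k {fg gf} => [|k ih]; first exact: congruence_refl.
  by rewrite exprS -[1]mulr1; exact: (congruence_mul cE).
have absorb a b : a + b * h ^+ k = b * h ^+ k -> E (a + b, b).
  have Eb : E (b * h ^+ k, b).
    rewrite -[in X in E (_, X)](mulr1 b); apply: (congruence_mul cE) => //.
    exact: congruence_refl.
  move=> ab; apply: (congruence_trans cE _ Eb); rewrite -ab.
  apply: (congruence_add cE); first exact: congruence_refl.
  exact: (congruence_sym cE Eb).
apply: (congruence_trans cE) (absorb _ _ fg).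
by rewrite addrC; apply: (congruence_sym cE); exact: absorb.
Qed.

Definition violation P x : R := \big[Num.max/0]_(l <- P) qeval l x.

Lemma violation_ge0 P x : 0 <= violation P x.
Proof. exact: bigmax_ge_id. Qed.

Lemma qeval_le_violation P x l : l \in P -> qeval l x <= violation P x.
Proof.
by move=> lP; exact: (@le_bigmax_seq _ _ _ P 0 l xpredT (fun l => qeval l x)).
Qed.

Lemma violation_eq0 P x : all (fun l => qeval l x <= 0) P -> violation P x = 0.
Proof.
move=> /allP Px; apply/le_anti; rewrite violation_ge0 andbT /violation big_seq.
exact: bigmax_le.
Qed.

Lemma hoffman_violation P : (exists x, all (fun l => qeval l x <= 0) P) ->
  exists2 C, 0 <= C & forall x,
    exists2 y, near_pt (C * violation P x) x y & all (fun l => qeval l y <= 0) P.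
Proof.
move=> [x0 /allP Px0]; have [|C C0 hC] := @hoffman R n [seq realform l | l <- P].
  by exists x0 => _ /mapP[l lP ->]; exact: Px0.
exists C => // x; have [|y xy Py] := hC x _ (violation_ge0 P x).
  by move=> _ /mapP[l lP ->]; exact: qeval_le_violation.
by exists y => //; apply/allP => l lP; apply: Py; exact: map_f.
Qed.

Lemma uniform_hoffman s :
  (forall P, P \in s -> exists x, all (fun l => qeval l x <= 0) P) ->
  exists2 C, 0 <= C & forall P x, P \in s ->
    exists2 y, near_pt (C * violation P x) x y & all (fun l => qeval l y <= 0) P.
Proof.
elim: s => [|P s ih] sn; first by exists 0.
have [|C C0 hC] := ih; first by move=> Q Qs; apply: sn; rewrite inE Qs orbT.
have [|D D0 hD] := @hoffman_violation P; first by apply: sn; rewrite mem_head.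
exists (C + D); first exact: addr_ge0.
have wide (a b r : R) x y :
    a <= b -> 0 <= r -> near_pt (a * r) x y -> near_pt (b * r) x y.
  by move=> ab r0 xy j; apply: le_trans (xy j) _; rewrite ler_wpM2r.
move=> Q x; rewrite inE => /predU1P[->|Qs].
  have [y xy Py] := hD x; exists y => //.
  by apply: wide xy; rewrite ?lerDr ?violation_ge0.
have [y xy Qy] := hC Q x Qs; exists y => //.
by apply: wide xy; rewrite ?lerDl ?violation_ge0.
Qed.

(** Hoffman's bound is about feasible systems, so empty pieces are discarded. *)
Lemma nonempty_pieces V : polyhedral_union V ->
  exists2 s, (forall x, V x <-> has (all (fun l => qeval l x <= 0)) s) &
    forall P, P \in s -> exists x, all (fun l => qeval l x <= 0) P.
Proof.
move=> [s sV].
pose ne P := `[< exists x : 'rV[R]_n, all (fun l => qeval l x <= 0) P >].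
exists [seq P <- s | ne P] => [x|P]; last by rewrite mem_filter => /andP[/asboolP].
rewrite sV; split=> /hasP[P Ps Px]; apply/hasP; exists P => //.
  by rewrite mem_filter Ps andbT; apply/asboolP; exists x.
by move: Ps; rewrite mem_filter => /andP[].
Qed.

(** [h] is a multiple of the minimal violation over the pieces of [closure V];
    Hoffman's bound is applied to the piece attaining the minimum. *)
Lemma polyhedral_gauge V : V !=set0 -> polyhedral_union (closure V) ->
  exists h, EV V (h, 1) /\
    exists2 C : R, 0 <= C & forall x, exists y, exists2 r : R,
      closure V y & [/\ 0 <= r, near_pt (C * r) x y & tle (Some r) (rfeval x h)].
Proof.
move=> [x0 Vx0] /nonempty_pieces[[|P0 s] sV sn].
  by have /sV := subset_closure Vx0.
set t := P0 :: s in sV sn.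
pose gauge x := \big[Num.min/violation P0 x]_(P <- t) violation P x.
(* Multiplying by [D >= 1] keeps the zeros and only increases the gauge. *)
have [D D0 [h hE]] : rationally_tropical gauge.
  have vT P : rationally_tropical (violation P).
    apply: rationally_tropical_bigmax => [|l]; last exact: rationally_tropical_qeval.
    exact/rationally_tropical_of/tropical_cst.
  exact: rationally_tropical_bigmin.
have gauge0 x : closure V x -> gauge x = 0.
  move=> /sV/hasP[P Pt Px]; apply/le_anti/andP; split.
    rewrite -(violation_eq0 Px).
    exact: (@ge_bigmin_seq _ _ _ t _ P xpredT (fun P => violation P x)).
  by apply: le_bigmin => [|? _]; exact: violation_ge0.
have gauge_att x : exists2 P, P \in t & gauge x = violation P x.
  rewrite /gauge; have : {subset t <= t} by [].
  elim: {1 4}t => [|P r ih] rt.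
    by exists P0; [rewrite mem_head|rewrite big_nil].
  have [|Q Qt QE] := ih; first by move=> Q Qr; apply: rt; rewrite inE Qr orbT.
  rewrite big_cons; case: leP => _; last by exists Q.
  by exists P => //; apply: rt; rewrite mem_head.
exists h; split.
  move=> x /subset_closure/gauge0 gx /=.
  by rewrite hE gx mulr0 rfeval1.
have [C C0 hC] := uniform_hoffman sn; exists C => // x.
have [P Pt gP] := gauge_att x; have [y xy Py] := hC P x Pt.
exists y, (violation P x); first by apply/sV/hasP; exists P.
split=> //; first exact: violation_ge0.
by rewrite hE gP; apply/tle_Some; rewrite ler_peMl ?violation_ge0// ler1n.
Qed.

(** For nonempty [V] the pair of [polyhedral_gauge] generates; the empty set
    corresponds to the full congruence, generated by [(1, 0)]. *)
Lemma polyhedral_fg V : polyhedral_union (closure V) -> fg_congruence (EV V).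
Proof.
move=> Vpol; have [->|/set0P V0] := eqVneq V set0.
  exists [set (1, 0)]; split; [exact: finite_set1|by move=> ? _ ?|].
  apply/seteqP; split; last by move=> ? _ ?.
  move=> [f g] _ E [cE E1].
  have E10 : E (1, 0) by exact: E1.
  have zero a : E (a, 0).
    rewrite -[in X in E (X, _)](mulr1 a) -(mulr0 a).
    by apply: (congruence_mul cE) => //; exact: congruence_refl.
  by apply: (congruence_trans cE) (zero f) _; exact: (congruence_sym cE).
have [h [hV [C C0 hC]]] := polyhedral_gauge V0 Vpol.
exists [set (h, 1)]; split; first exact: finite_set1.
  by move=> _ ->.
apply/seteqP; split; last first.
  by apply: smallest_sub; [exact: EV_congruence|move=> _ ->].
move=> [f g] fg E [cE Eh].
have {}Eh : E (h, 1) by exact: Eh.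
have bound f' g' : EV V (f', g') -> exists k0, forall k, (k0 <= k)%N ->
    f' + g' * h ^+ k = g' * h ^+ k.
  rewrite -EV_closure => fg'; have [L L0 hL] := agree_nearby f' g'.
  (* At distance at most [C * r] the two functions differ by at most
     [L * C * r], and [h] is at least [r]. *)
  exists (Num.truncn (L * C)).+1 => k kLC.
  have {}kLC : L * C <= k%:R.
    by apply: le_trans (ltW (truncnS_gt _)) _; rewrite ler_nat.
  apply: rfeval_inj => x; rewrite rfevalD rfevalM.
  have [y [r Vy [r0 xy rh]]] := hC x.
  apply: tle_trans (hL _ x y (mulr_ge0 C0 r0) xy (fg' y Vy)) _.
  apply: tleM (tle_refl _) _.
  apply: (@tle_trans _ (Some (k%:R * r))).
    by apply/tle_Some; rewrite mulrA ler_wpM2r.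
  elim: k {kLC} => [|k ih]; first by rewrite mul0r rfeval1; exact: tle_refl.
  by rewrite exprS rfevalM mulrS mulrDl mul1r -tmul_Some; exact: tleM.
have [k1 hk1] := bound f g fg.
have [k2 hk2] := bound g f (congruence_sym (EV_congruence V) fg).
apply: (congruence_sandwich cE Eh) (hk1 (maxn k1 k2) _) (hk2 _ _).
  exact: leq_maxl.
exact: leq_maxr.
Qed.

End Backward.

Theorem theorem1p1 (R : realType) (n : nat) (hn : (1 <= n)%N)
    (V : set 'rV[R]_n) :
  fg_congruence (EV V) <->
  exists (k : nat) (P : 'I_k -> set 'rV[R]_n),
    (forall i, rational_polyhedral (P i)) /\ closure V = \bigcup_i P i.
Proof.
rewrite -polyhedral_unionP.
by split; [exact: fg_polyhedral|exact: polyhedral_fg].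
Qed.
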